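(* (i) Suppose $A=\langle\langle a,b\rangle\rangle$ has dimension $2$, where $a,b$ are nontrivial axes. Then $a$ and $b$ are weakly primitive axes, and writing $ab=\rho a+\xi b$ and $ba=\xi'a+\rho'b$, the eigenvalues of $a$ are $1$ and $(\xi,\rho')$ and the eigenvalues of $b$ are $1$ and $(\xi',\rho)$. The idempotents of $A$ are $b$, and all elements of the form (a) $\frac{1}{1+\gamma}(a+\gamma b)$ when $\xi'+\rho=\rho'+\xi=1$ and $\gamma\ne-1$ (with $\gamma\in\mathbb F$), or (b) $\frac{1}{1+\gamma(\xi'+\rho)}(a+\gamma b)$ when $\xi'+\rho\ne1$ and $\gamma=\frac{\rho'+\xi-1}{\xi'+\rho-1}$. (ii) With the same $A,a,b,\rho,\xi,\rho',\xi'$, either (a) (the commutative case) $\xi'=\rho$ and $\rho'=\xi$. In this case $a$ has eigenvalues $1$ and $\xi$, and $b$ has eigenvalues $1$ and $\rho$. The axes satisfy the fusion rules if and only if $\xi=\rho\in\{0,\frac12,-1\}$. (If $\xi=\rho=0$ then $ab=ba=0$, i.e., $A\cong\mathbb F\times\mathbb F$.) or (b) (the noncommutative case) $\xi+\rho=1$ and $\xi'+\rho'=1$, and $\rho,\rho'\ne\frac12$. In case $(\xi,\rho')\neq(1,1)$ and $(\xi',\rho)\ne(1,1)$, the axis $a$ satisfies the fusion rules if and only if $\xi=\xi'$ (implying $\rho=\rho'$), in which case $b$ also satisfies the fusion rules, and $A\cong U_E(\xi,\rho)$. In case $(\xi,\rho)=(1,0)$, $A$ is a left-zero band algebra, and in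 case $(\xi,\rho)=(0,1)$, $A$ is a right-zero band algebra.
   Context: $\mathbb F$ is a field of characteristic $\ne 2$. Algebras are $\mathbb F$-algebras, not assumed associative, commutative or unital; $\langle\langle X\rangle\rangle$ is the subalgebra generated by $X$. For $y\in A$ put $L_y(z)=yz$, $R_y(z)=zy$; $A_\mu(L_y)$ and $A_\nu(R_y)$ denote eigenspaces. An axis of $A$ is an idempotent $a$ such that $A$ is the direct sum of the eigenspaces of $L_a$, $A$ is the direct sum of the eigenspaces of $R_a$, and $L_aR_a=R_aL_a$. An idempotent is nontrivial if it is neither $0$ nor an identity element of $A$. Let $S_L(a),S_R(a)$ be the sets of eigenvalues of $L_a,R_a$; $A_{\mu,\nu}(a)=A_\mu(L_a)\cap A_\nu(R_a)$; $A_\mu(a)=A_{\mu,\mu}(a)$; $S=S(a)=(S_L(a)\times S_R(a))\setminus\{(0,0),(1,1)\}$. So $A=A_1(a)\oplus A_0(a)\oplus\bigoplus_{(\mu,\nu)\in S}A_{\mu,\nu}(a)$. A nonzero element of $A_{\mu,\nu}(a)$ is an eigenvector of $a$ with (two-sided) eigenvalue $(\mu,\nu)$; $1$ stands for the eigenvalue $(1,1)$, and $\mu$ for $(\mu,\mu)$ in the commutative case. The axis $a$ is weakly primitive if $A_1(a)=\mathbb F a$. The axis $a$ satisfies the fusion rules if: (a) $A_{\mu,\nu}(a)A_{\mu',\nu'}(a)=0$ for all $(\mu,\nu)\neq(\mu',\nu')$ in $S$; (b) $A_{\mu,\nu}(a)^2\subseteq A_0(a)+A_1(a)$ for $(\mu,\nu)\in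 S$; (c) $(A_0(a)+A_1(a))(A_0(a)+A_1(a))\subseteq A_0(a)+A_1(a)$; (d) $(A_1(a)+A_0(a))A_{\mu,\nu}(a)\subseteq A_{\mu,\nu}(a)$ and $A_{\mu,\nu}(a)(A_1(a)+A_0(a))\subseteq A_{\mu,\nu}(a)$ for $(\mu,\nu)\in S$. For a set $E=\{x_i:i\in I\}$ of idempotents, $U_E(\mu,\nu)$ is the algebra generated by $E$ (and spanned by $E$) satisfying $x_ix_j=\nu x_i+\mu x_j$ for all $i\neq j$ in $I$, where $\mu\ne\nu$ or $\mu=\nu\notin\{0,1\}$; in the claim, $E$ is the set of the two generators. The left-zero (resp. right-zero) band on $E$ is the semigroup with product $x_ix_j=x_i$ (resp. $x_ix_j=x_j$), and the left-zero (resp. right-zero) band algebra is its semigroup algebra.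
   Formalization: The list of idempotents also includes 0 and a, and form (b) requires a nonzero denominator; in (ii)(b) ρ and ρ' are not both 1/2 (each is ≠1/2 when ξ=ξ'); left-zero and right-zero are interchanged, and the band claims are made for ξ=ξ'. *)

(* Defs.v *)
From HB Require Import structures.
From mathcomp Require Import all_boot all_order all_algebra.

Set Implicit Arguments.
Unset Strict Implicit.
Unset Printing Implicit Defensive.

Import GRing.Theory.
Local Open Scope ring_scope.

(* An F-algebra, not assumed associative, commutative or unital, is a vector  *)
(* space A together with a product m : {bilinear A -> A -> A}. Since A is     *)
(* finite-dimensional, {vspace A} accounts for all of its subspaces, and      *)
(* every endomorphism has finitely many eigenvalues.                          *)
Section Axes.
Variables (F : fieldType) (A : vectType F) (m : {bilinear A -> A -> A}).

Definition subalgebra (V : {vspace A}) : Prop :=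
  forall x y, x \in V -> y \in V -> m x y \in V.

Definition in_gen (X : seq A) (x : A) : Prop :=
  forall V : {vspace A}, subalgebra V -> {subset X <= V} -> x \in V.

Definition idempotent_elt (x : A) : Prop := m x x = x.

Definition identity_element (e : A) : Prop :=
  forall x, m e x = x /\ m x e = x.

Definition nontrivial (x : A) : Prop := x <> 0 /\ ~ identity_element x.

Definition Lmul (y : A) : 'End(A) := linfun (m y).
Definition Rmul (y : A) : 'End(A) := linfun (applyr m y).

Definition sum_of_eigenspaces (f : 'End(A)) : Prop :=
  exists s : seq F,
    [/\ uniq s,
        forall mu, (mu \in s) = passmx.leigenvalue f mu,
        directv (\sum_(mu <- s) passmx.leigenspace f mu)
      & (\sum_(mu <- s) passmx.leigenspace f mu)%VS = fullv].

Definition axis (a : A) : Prop :=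
  [/\ idempotent_elt a,
      sum_of_eigenspaces (Lmul a),
      sum_of_eigenspaces (Rmul a)
    & (Lmul a \o Rmul a)%VF = (Rmul a \o Lmul a)%VF].

Definition eigenspace2 (a : A) (p : F * F) : {vspace A} :=
  (passmx.leigenspace (Lmul a) p.1 :&: passmx.leigenspace (Rmul a) p.2)%VS.

Definition eigenvalue2 (a : A) (p : F * F) : Prop :=
  exists2 x, x != 0 & x \in eigenspace2 a p.

Definition weakly_primitive (a : A) : Prop :=
  eigenspace2 a (1, 1) = <[a]>%VS.

Definition S_of (a : A) (p : F * F) : Prop :=
  [/\ passmx.leigenvalue (Lmul a) p.1, passmx.leigenvalue (Rmul a) p.2,
      p <> (0, 0) & p <> (1, 1)].

Definition A01 (a : A) : {vspace A} :=
  (eigenspace2 a (0%R, 0%R) + eigenspace2 a (1%R, 1%R))%VS.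

Definition fusion_rules (a : A) : Prop :=
  [/\ forall p q, S_of a p -> S_of a q -> p <> q ->
        forall x y, x \in eigenspace2 a p -> y \in eigenspace2 a q -> m x y = 0,
      forall p, S_of a p ->
        forall x y, x \in eigenspace2 a p -> y \in eigenspace2 a p ->
          m x y \in A01 a,
      subalgebra (A01 a)
    & forall p, S_of a p ->
        forall x y, x \in A01 a -> y \in eigenspace2 a p ->
          m x y \in eigenspace2 a p /\ m y x \in eigenspace2 a p].

End Axes.

Definition alg_isom (F : fieldType) (A B : vectType F)
    (mA : A -> A -> A) (mB : B -> B -> B) (f : {linear A -> B}) : Prop :=
  bijective f /\ {morph f : x y / mA x y >-> mB x y}.

Section Models.
Variables (F : fieldType) (I : finType).

Definition basis_elt (i : I) : {ffun I -> F^o} := [ffun j => (j == i)%:R].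

(* The product of the algebra with basis (x_i) and x_i x_j = c i j. *)
Definition table_mul (c : I -> I -> {ffun I -> F^o}) (u v : {ffun I -> F^o}) :
    {ffun I -> F^o} :=
  \sum_i \sum_j (u i * v j : F) *: c i j.

Lemma table_mul_bilinear c :
  bilinear_for (GRing.Scale.Law.clone _ _ *:%R _)
    (GRing.Scale.Law.clone _ _ *:%R _) (table_mul c).
Proof.
split=> [v | u] k x y /=; rewrite /table_mul scaler_sumr -big_split /=;
  apply: eq_bigr => i _; rewrite scaler_sumr -big_split /=;
  apply: eq_bigr => j _; rewrite !ffunE scalerA -scalerDl; congr (_ *: _).
- by rewrite mulrDl mulrA.
- by rewrite mulrDr mulrCA.
Qed.

Lemma table_mulE c i j : table_mul c (basis_elt i) (basis_elt j) = c i j.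
Proof.
rewrite /table_mul (bigD1 i) //= (bigD1 j) //= !ffunE !eqxx mulr1 scale1r.
rewrite !big1 ?addr0 // => k /negPf ki.
  by rewrite big1 // => l _; rewrite !ffunE ki mul0r scale0r.
by rewrite !ffunE ki mulr0 scale0r.
Qed.

HB.instance Definition _ c :=
  bilinear_isBilinear.Build F {ffun I -> F^o} {ffun I -> F^o} {ffun I -> F^o}
    *:%R *:%R (table_mul c) (table_mul_bilinear c).

(* U_E(mu, nu) is only defined for these parameters. *)
Definition UE_params (mu nu : F) : Prop :=
  mu <> nu \/ [/\ mu = nu, mu <> 0 & mu <> 1].

Definition UE_mul (mu nu : F) :
    {bilinear {ffun I -> F^o} -> {ffun I -> F^o} -> {ffun I -> F^o}} :=
  table_mul (fun i j => if i == j then basis_elt i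
                        else nu *: basis_elt i + mu *: basis_elt j).

Definition semigroup_alg_mul (op : I -> I -> I) :
    {bilinear {ffun I -> F^o} -> {ffun I -> F^o} -> {ffun I -> F^o}} :=
  table_mul (fun i j => basis_elt (op i j)).

Definition left_zero_band (i j : I) : I := i.
Definition right_zero_band (i j : I) : I := j.

(* Isomorphism onto an algebra with basis (x_i), matching e_i with x_i. *)
Definition isom_on (A : vectType F) (m : A -> A -> A) (e : I -> A)
    (mI : {ffun I -> F^o} -> {ffun I -> F^o} -> {ffun I -> F^o}) : Prop :=
  exists2 f : {linear A -> {ffun I -> F^o}},
    alg_isom m mI f & forall i, f (e i) = basis_elt i.

End Models.

(* Main.v *)
(* Since [L_a] and [R_a] are diagonalizable, commute and fix [a], they have a
   common eigenvector [b + c a] besides [a], that is, [rho = c (xi - 1)] and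
   [xi' = c (rho' - 1)]; the fusion rules for [a] then reduce to
   [(b + c a)^2 \in F a], unless [(xi, rho') = (0, 0)].  Likewise
   [rho' = d (xi' - 1)] and [xi = d (rho - 1)] for [b].  Eliminating yields
   [(c d - 1) (rho' - xi) = 0]: either [rho' = xi], which is the commutative
   case, or [c d = 1], which forces [c = d = -1] and hence
   [xi + rho = xi' + rho' = 1]. *)
Require Import Defs.
From mathcomp Require Import all_boot all_order all_algebra.
From mathcomp Require Import ring.
Import GRing.Theory.
Local Open Scope ring_scope.

Set Implicit Arguments.
Unset Strict Implicit.
Unset Printing Implicit Defensive.

(** * Bases and coordinates in a two-dimensional algebra *)

Lemma basis2_dependent (F : fieldType) (A : vectType F) (a b : A) :
  \dim {:A} = 2%N -> ~~ basis_of {:A} [:: a; b] ->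
  a != 0 -> exists c, b = c *: a.
Proof.
move=> dimA; rewrite basisEfree dimA subvf andbT free_cons seq1_free span_seq1.
rewrite negb_and => nb an0; have [-> | bn0] := eqVneq b 0.
  by exists 0; rewrite scale0r.
move: nb; rewrite bn0 orbF negbK => /vlineP[k ak]; exists k^-1.
rewrite ak scalerA mulVf ?scale1r //.
by apply: contraNneq an0 => k0; rewrite ak k0 scale0r.
Qed.

(** If [b] were a multiple of [a], the line [<[a]>] would be a subalgebra containing both
    generators, hence all of [A], against dimension 2. *)
Lemma in_gen_basis2 (F : fieldType) (A : vectType F)
    (m : {bilinear A -> A -> A}) (a b : A) :
  \dim {:A} = 2%N -> (forall x, in_gen m [:: a; b] x) ->
  a != 0 -> m a a = a -> basis_of {:A} [:: a; b].
Proof.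
move=> dimA genA an0 aa; apply: contraT => nb.
have [c bE] := basis2_dependent dimA nb an0.
suff: (fullv <= <[a]>)%VS.
  by move/dimvS; rewrite dimA dim_vline; case: (a != 0).
apply/subvP=> x _; apply: genA => [u v|y].
  case/vlineP=> k ->; case/vlineP=> l ->.
  by rewrite linearZl_LR linearZr_LR aa !memvZ ?memv_line.
by rewrite !inE => /orP[] /eqP->; rewrite ?bE ?memvZ ?memv_line.
Qed.

(** Keeps both coefficients explicit, so that an identity in [A] becomes two scalar identities for
    [ring] or [field]. *)
Definition lc (F : fieldType) (A : vectType F) (a b : A) (x y : F) : A :=
  x *: a + y *: b.

Section LinearCombinations.
Variables (F : fieldType) (A : vectType F) (a b : A).

Lemma lcC x y : lc a b x y = lc b a y x.
Proof. exact: addrC. Qed.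

Lemma lcD x y z t : lc a b x y + lc a b z t = lc a b (x + z) (y + t).
Proof. by rewrite /lc !scalerDl addrACA. Qed.

Lemma lcZ k x y : k *: lc a b x y = lc a b (k * x) (k * y).
Proof. by rewrite /lc scalerDr !scalerA. Qed.

Lemma lc10 : a = lc a b 1 0.
Proof. by rewrite /lc scale1r scale0r addr0. Qed.

Lemma lc01 : b = lc a b 0 1.
Proof. by rewrite /lc scale1r scale0r add0r. Qed.

Lemma lcx0 x : lc a b x 0 = x *: a.
Proof. by rewrite /lc scale0r addr0. Qed.

Lemma lc0x y : lc a b 0 y = y *: b.
Proof. by rewrite /lc scale0r add0r. Qed.

Lemma lc00 : 0 = lc a b 0 0.
Proof. by rewrite /lc !scale0r addr0. Qed.

Hypothesis ab_basis : basis_of {:A} [:: a; b].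

Lemma lc_surj u : exists x y, u = lc a b x y.
Proof.
have := memvf u; rewrite -(span_basis ab_basis) span_cons span_seq1.
by case/memv_addP=> _ /vlineP[x ->] [_ /vlineP[y ->] ->]; exists x, y.
Qed.

Lemma lc_eq0 x y : lc a b x y = 0 -> x = 0 /\ y = 0.
Proof.
have := basis_free ab_basis; rewrite free_cons seq1_free span_seq1 /lc.
case/andP=> anb bn0 xy0.
have x0 : x = 0.
  apply: contraNeq anb => xn0; apply/vlineP; exists (- (x^-1 * y)).
  apply: (scalerI xn0); rewrite scalerA mulrN mulrA mulfV // mul1r scaleNr.
  by apply/eqP; rewrite -addr_eq0 xy0.
split=> //; move: xy0; rewrite x0 scale0r add0r => /eqP.
by rewrite scaler_eq0 (negPf bn0) orbF => /eqP.
Qed.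

Lemma lc_inj x y z t : lc a b x y = lc a b z t -> x = z /\ y = t.
Proof.
move/eqP; rewrite -subr_eq0 -scaleN1r lcZ lcD !mulN1r => /eqP/lc_eq0[].
by move=> /eqP + /eqP; rewrite !subr_eq0 => /eqP-> /eqP->.
Qed.

End LinearCombinations.

Lemma basis2C (F : fieldType) (A : vectType F) (a b : A) :
  basis_of {:A} [:: a; b] -> basis_of {:A} [:: b; a].
Proof.
by rewrite (@perm_basis _ _ _ [:: b; a]) // (perm_catC [:: a] [:: b]).
Qed.

(** Serves to replace [b] by a common eigenvector [b + c a], since
    [x a + y b = (x - y c) a + y (b + c a)]. *)
Lemma basis2_transvection (F : fieldType) (A : vectType F) (a b : A) c :
  basis_of {:A} [:: a; b] -> basis_of {:A} [:: a; lc a b c 1].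
Proof.
move=> ab_basis; rewrite basisEdim.
rewrite (size_basis (X := [tuple a; b]) ab_basis) leqnn andbT.
apply/subvP=> u _; have [x [y ->]] := lc_surj ab_basis u.
rewrite span_cons span_seq1; apply/memv_addP.
exists ((x - y * c) *: a); first by rewrite memvZ ?memv_line.
exists (y *: lc a b c 1); first by rewrite memvZ ?memv_line.
rewrite -(lcx0 a b) lcZ lcD /=; congr lc; ring.
Qed.

Section Products.
Variables (F : fieldType) (A : vectType F) (m : {bilinear A -> A -> A}).
Variables (a b : A) (rho xi rho' xi' : F).
Hypotheses (aa : m a a = a) (bb : m b b = b).
Hypotheses (ab : m a b = lc a b rho xi) (ba : m b a = lc a b xi' rho').

Lemma mul_lc x y z t : m (lc a b x y) (lc a b z t) =
  lc a b (x * z + x * t * rho + y * z * xi')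
         (y * t + x * t * xi + y * z * rho').
Proof.
rewrite {1 2}/lc !(linearDl, linearDr, linearZl_LR, linearZr_LR) aa bb ab ba.
rewrite -[z *: a](lcx0 a b) -[t *: b](lc0x a b).
by rewrite !(lcZ, lcD) /=; congr lc; ring.
Qed.

End Products.

(* As [(f - 1)^2 = 0], every eigenvalue of [f] is 1. *)
Lemma unipotent_sum_of_eigenspaces (F : fieldType) (A : vectType F)
    (f : 'End(A)) :
  sum_of_eigenspaces f -> (forall u, f (f u - u) = f u - u) ->
  forall u, f u = u.
Proof.
case=> s [_ _ _ full_s] ff1 u; apply/eqP; rewrite -subr_eq0.
(* Phrased as membership in a subspace, the goal need only be checked on each eigenspace of the
   sum. *)
suff: u \in lker (f - \1%VF) by rewrite memv_ker !lfun_simp.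
have := memvf u; rewrite -full_s; move: u; apply/subvP.
apply: (big_ind (fun V => V <= _)%VS) => [|V W|mu _]; first exact: sub0v.
  by rewrite subv_add => -> ->.
apply/subvP=> u; rewrite !memv_ker !lfun_simp subr_eq0 => /eqP fu.
have muE : mu *: u - u = (mu - 1) *: u by rewrite scalerBl scale1r.
have := ff1 u; rewrite fu muE linearZ /= fu scalerA => /eqP.
rewrite -subr_eq0 -scalerBl.
have ->: (mu - 1) * mu - (mu - 1) = (mu - 1) ^+ 2 by ring.
by rewrite !scaler_eq0 expf_eq0.
Qed.

(** * Eigenspaces and fusion rules in a basis of common eigenvectors *)

Section EigenBasis.
Variables (F : fieldType) (A : vectType F) (m : {bilinear A -> A -> A}).
Variables (a v : A) (mu nu : F).
Hypotheses (av_basis : basis_of {:A} [:: a; v]) (aa : m a a = a).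
Hypotheses (av : m a v = mu *: v) (va : m v a = nu *: v).
Hypothesis munu_neq1 : (mu, nu) <> (1, 1).

Let v_neq0 : v != 0.
Proof. by apply: (basis_not0 av_basis); rewrite !inE eqxx orbT. Qed.

Lemma mem_eigenspace2 u p :
  u \in eigenspace2 m a p <-> m a u = p.1 *: u /\ m u a = p.2 *: u.
Proof.
rewrite memv_cap !memv_ker !lfun_simp /= !subr_eq0.
by split=> [/andP[/eqP-> /eqP->] //|[-> ->]]; rewrite !eqxx.
Qed.

Lemma mem_eigenspace2_lc x y p : lc a v x y \in eigenspace2 m a p <->
  (x = 0 \/ p = (1, 1)) /\ (y = 0 \/ p = (mu, nu)).
Proof.
rewrite mem_eigenspace2; case: p => s t /=.
have -> : m a (lc a v x y) = lc a v x (y * mu).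
  by rewrite /lc linearDr !linearZr_LR aa av scalerA.
have -> : m (lc a v x y) a = lc a v x (y * nu).
  by rewrite /lc linearDl !linearZl_LR aa va scalerA.
rewrite !lcZ; split.
  case=> /(lc_inj av_basis)[e1 e2] /(lc_inj av_basis)[e3 e4]; split.
    have [-> | xn0] := eqVneq x 0; [by left | right].
    by congr (_, _); apply: (mulIf xn0); rewrite mul1r.
  have [-> | yn0] := eqVneq y 0; [by left | right].
  by congr (_, _); apply: (mulIf yn0); rewrite -?e2 -?e4 mulrC.
case=> [[->|st1] [->|st2]]; rewrite ?(mulr0, mul0r) //.
- by case: st2 => -> ->; split; congr lc; rewrite mulrC.
- by case: st1 => -> ->; rewrite mul1r.
(* Both coordinates can be nonzero only if the eigenvalue pairs of [a] and [v] coincide. *)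
- by case: munu_neq1; rewrite -st2.
Qed.

Lemma eigenspace2_other p :
  p <> (1, 1) -> p <> (mu, nu) -> forall u, u \in eigenspace2 m a p -> u = 0.
Proof.
move=> p1 p2 u; have [x [y ->]] := lc_surj av_basis u.
by rewrite mem_eigenspace2_lc => -[[->|//] [->|//]]; rewrite -lc00.
Qed.

Lemma eigenspace2_1 : eigenspace2 m a (1, 1) = <[a]>%VS.
Proof.
apply/vspaceP=> u; apply/idP/idP.
  have [x [y ->]] := lc_surj av_basis u.
  rewrite mem_eigenspace2_lc => -[_ [->|/esym//]].
  by rewrite lcx0 memvZ ?memv_line.
case/vlineP=> k ->; rewrite -(lcx0 a v) mem_eigenspace2_lc.
by split; [right | left].
Qed.

Lemma eigenspace2_munu : eigenspace2 m a (mu, nu) = <[v]>%VS.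
Proof.
apply/vspaceP=> u; apply/idP/idP.
  have [x [y ->]] := lc_surj av_basis u.
  rewrite mem_eigenspace2_lc => -[[->|//] _].
  by rewrite lc0x memvZ ?memv_line.
case/vlineP=> k ->; rewrite -(lc0x a v) mem_eigenspace2_lc.
by split; [left | right].
Qed.

Lemma eigenvalue2E p : eigenvalue2 m a p <-> p = (1, 1) \/ p = (mu, nu).
Proof.
split=> [[u un0 up] | p_eig].
  have [-> | /eqP p1] := eqVneq p (1, 1); first by left.
  have [-> | /eqP p2] := eqVneq p (mu, nu); first by right.
  by rewrite (eigenspace2_other p1 p2 up) eqxx in un0.
case: p_eig => ->; [exists a; last by rewrite eigenspace2_1 memv_line
                   |exists v; last by rewrite eigenspace2_munu memv_line].
  by apply: (basis_not0 av_basis); rewrite inE eqxx.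
exact: v_neq0.
Qed.

(** Only [(1, 1)] and [(mu, nu)] have nonzero eigenspaces. If [(mu, nu) = (0, 0)], then [A01] is all
    of [A] and every pair in [S] has zero eigenspace. Otherwise [A01] is the line of [a], and the
    only substantial condition is rule (b) for [v]. *)
Lemma fusion_rulesE :
  fusion_rules m a <-> (mu, nu) = (0, 0) \/ m v v \in <[a]>%VS.
Proof.
(* [S] comes from the product of two spectra, so it may contain pairs, such as [(1, nu)], whose
   two-sided eigenspace is zero. *)
have S_zero p : S_of m a p -> p <> (mu, nu) ->
    forall u, u \in eigenspace2 m a p -> u = 0.
  by case=> _ _ _ p1 p2; apply: eigenspace2_other.
have S_prod p q : S_of m a p -> S_of m a q -> p <> q ->
    forall x y, x \in eigenspace2 m a p -> y \in eigenspace2 m a q -> m x y = 0.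
  move=> Sp Sq pq x y xp yq; have [pE | /eqP p2] := eqVneq p (mu, nu).
    by rewrite (S_zero q Sq _ y yq) ?linear0r // => qE; apply: pq; rewrite pE.
  by rewrite (S_zero p Sp p2 x xp) linear0l.
have [munu0 | /eqP munu0] := eqVneq (mu, nu) (0, 0).
  have A01_full u : u \in A01 m a.
    have [x [y ->]] := lc_surj av_basis u.
    rewrite /A01 -munu0 eigenspace2_munu eigenspace2_1 /lc addrC.
    by rewrite memv_add ?memvZ ?memv_line.
  split=> [_|_]; first by left.
  split=> // [p Sp x y _ yp]; have yE : y = 0.
    by apply: (S_zero p) => // pE; case: Sp; rewrite pE.
  by rewrite yE linear0r linear0l mem0v.
have A01E : A01 m a = <[a]>%VS.
  rewrite /A01 eigenspace2_1; apply/addv_idPr/subvP=> u u0.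
  rewrite (eigenspace2_other _ _ u0) ?mem0v //; last exact/nesym.
  by case=> /esym/eqP; rewrite oner_eq0.
have S_munu : S_of m a (mu, nu).
  split=> //=; apply/eqP=> l0.
    have: v \in passmx.leigenspace (Lmul m a) mu.
      by rewrite memv_ker !lfun_simp /= av subrr.
    by rewrite l0 memv0 (negPf v_neq0).
  have: v \in passmx.leigenspace (Rmul m a) nu.
    by rewrite memv_ker !lfun_simp /= va subrr.
  by rewrite l0 memv0 (negPf v_neq0).
split=> [[_ sq_in _ _] | [//|vv_in]].
  by right; rewrite -A01E; apply: (sq_in (mu, nu));
    rewrite ?eigenspace2_munu ?memv_line.
split=> //.
- move=> p Sp x y xp yp; have [pE | /eqP p2] := eqVneq p (mu, nu).
    move: xp yp; rewrite A01E pE eigenspace2_munu.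
    case/vlineP=> k ->; case/vlineP=> l ->.
    by rewrite linearZl_LR linearZr_LR !memvZ.
  by rewrite (S_zero p Sp p2 x xp) linear0l mem0v.
- rewrite A01E => _ _ /vlineP[k ->] /vlineP[l ->].
  by rewrite linearZl_LR linearZr_LR aa !memvZ ?memv_line.
move=> p Sp x y; rewrite A01E => /vlineP[k ->] yp.
have [pE | /eqP p2] := eqVneq p (mu, nu); last first.
  by rewrite (S_zero p Sp p2 y yp) linear0l linear0r mem0v.
move: yp; rewrite pE eigenspace2_munu => /vlineP[l ->].
by rewrite !(linearZl_LR, linearZr_LR) av va !memvZ ?memv_line.
Qed.

End EigenBasis.

(** * A single axis: its second eigenvector and its fusion rules *)

(** In the basis [a, b] both [L_a] and [R_a] are triangular. Commutation makes their second
    eigenvectors agree, diagonalizability handles the eigenvalue 1, and nontriviality keeps the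
    second pair away from [(1, 1)]. *)
Lemma two_generated_axis (F : fieldType) (A : vectType F)
    (m : {bilinear A -> A -> A}) (a b : A) (rho xi rho' xi' : F) :
  basis_of {:A} [:: a; b] -> m a a = a -> m b b = b ->
  m a b = lc a b rho xi -> m b a = lc a b xi' rho' ->
  axis m a -> nontrivial m a ->
  exists c, [/\ rho = c * (xi - 1) /\ xi' = c * (rho' - 1),
    (xi, rho') <> (1, 1),
    weakly_primitive m a,
    forall p, eigenvalue2 m a p <-> p = (1, 1) \/ p = (xi, rho')
  & fusion_rules m a <-> (xi, rho') = (0, 0) \/ 1 + c * (xi + rho') = 0].
Proof.
move=> ab_basis aa bb ab ba [_ L_diag R_diag LR] [_ a_not_id].
have mE := mul_lc aa bb ab ba.
have LE x y : m a (lc a b x y) = lc a b (x + y * rho) (y * xi).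
  by have := mE 1 0 x y; rewrite -lc10 => ->; congr lc; ring.
have RE x y : m (lc a b x y) a = lc a b (x + y * xi') (y * rho').
  by have := mE x y 1 0; rewrite -lc10 => ->; congr lc; ring.
(* The [a]-coordinate of [(ba)], multiplied on the left by [a], against that of [(ab)a];
   equivalently [rho (rho' - 1) = xi' (xi - 1)]. *)
have comm : xi' + rho' * rho = rho + xi * xi'.
  have := congr1 (fun f : 'End(A) => f b) LR.
  rewrite !lfun_simp /= ab ba LE RE.
  by case/(lc_inj ab_basis).
(* For [xi = 1] the image of [L_a - 1] lies in the line of [a], which [L_a] fixes; diagonalizability
   then gives [L_a = 1]. *)
have rho0 : xi = 1 -> rho = 0.
  move=> xi1; suff: m a b = b.
    by rewrite ab [RHS](lc01 a b) => /(lc_inj ab_basis)[].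
  have := @unipotent_sum_of_eigenspaces _ _ _ L_diag.
  move/(_ _ b); rewrite lfunE; apply=> u; rewrite !lfunE /=.
  have [x [y ->]] := lc_surj ab_basis u.
  by rewrite LE -scaleN1r lcZ lcD LE xi1; congr lc; ring.
have xi'0 : rho' = 1 -> xi' = 0.
  move=> rho'1; suff: m b a = b.
    by rewrite ba [RHS](lc01 a b) => /(lc_inj ab_basis)[].
  have := @unipotent_sum_of_eigenspaces _ _ _ R_diag.
  move/(_ _ b); rewrite lfunE; apply=> u; rewrite !lfunE /=.
  have [x [y ->]] := lc_surj ab_basis u.
  by rewrite RE -scaleN1r lcZ lcD RE rho'1; congr lc; ring.
have neq1 : (xi, rho') <> (1, 1).
  case=> xi1 rho'1; apply: a_not_id => u.
  have [x [y ->]] := lc_surj ab_basis u.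
  by rewrite LE RE rho0 // xi'0 // xi1 rho'1 !mulr0 !mulr1 addr0.
(* Either equation determines [c] when its factor is nonzero, and [neq1] says that one of [xi - 1],
   [rho' - 1] is; [comm] or [rho0] gives the other equation. *)
have [c [rhoE xi'E]] : exists c, rho = c * (xi - 1) /\ xi' = c * (rho' - 1).
  have [xi1 | xi_neq1] := eqVneq xi 1; last first.
    have xi_sub1 : xi - 1 != 0 by rewrite subr_eq0.
    exists (rho / (xi - 1)); split; first by field.
    have: xi' * (xi - 1) = rho * (rho' - 1) 
      by rewrite mulrBr [xi' * xi]mulrC -[xi * xi'](addKr rho) -comm; ring.
    by move=> E; apply: (mulIf xi_sub1); rewrite E; field.
  have rho'_sub1 : rho' - 1 != 0.
    by rewrite subr_eq0; apply/eqP=> rho'1; apply: neq1; rewrite xi1 rho'1.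
  exists (xi' / (rho' - 1)); rewrite rho0 // xi1 subrr mulr0.
  by split=> //; field.
pose v := lc a b c 1.
have av_basis : basis_of {:A} [:: a; v] by exact: basis2_transvection.
have av : m a v = xi *: v by rewrite LE lcZ rhoE; congr lc; ring.
have va : m v a = rho' *: v by rewrite RE lcZ xi'E; congr lc; ring.
exists c; split=> //; first exact: (eigenspace2_1 av_basis aa av va).
  exact: (eigenvalue2E av_basis aa av va).
(* The [b]-coordinate of [v v] is [1 + c (xi + rho')], so its vanishing means that [v v] lies in the
   line of [a]. *)
rewrite (fusion_rulesE av_basis aa av va) // /v mE.
split=> -[|]; [by left | | by left | ] => [vv | c0]; right.
  case/vlineP: vv => k; rewrite -(lcx0 a b) => /(lc_inj ab_basis)[_ <-]; ring.
rewrite [X in lc _ _ _ X](_ : _ = 0) ?lcx0 ?memvZ ?memv_line //.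
by rewrite -[RHS]c0; ring.
Qed.

(** * Idempotents of the algebra *)

(** For [u = x a + y b] with [x, y] nonzero, [u u = u] reduces to the linear system [x + y s = 1],
    [y + x t = 1]. With [g = y / x] it becomes [1 + g s = 1 / x] and [g (s - 1) = t - 1]: [g] is
    determined when [s] differs from 1, and otherwise [t = 1]. *)
Lemma idempotent_lc (F : fieldType) (A : vectType F)
    (m : {bilinear A -> A -> A}) (a b : A) (rho xi rho' xi' : F) :
  basis_of {:A} [:: a; b] -> m a a = a -> m b b = b ->
  m a b = lc a b rho xi -> m b a = lc a b xi' rho' ->
  forall x : A, idempotent_elt m x <->
    [\/ x = 0,
        x = a \/ x = b,
        exists gamma : F,
          [/\ xi' + rho = 1, rho' + xi = 1, gamma <> -1
            & x = (1 + gamma)^-1 *: (a + gamma *: b)]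
      | exists gamma : F,
          [/\ xi' + rho <> 1,
              gamma = (rho' + xi - 1) / (xi' + rho - 1),
              1 + gamma * (xi' + rho) <> 0
            & x = (1 + gamma * (xi' + rho))^-1 *: (a + gamma *: b)]].
Proof.
move=> ab_basis aa bb ab ba u; rewrite /idempotent_elt.
have mE := mul_lc aa bb ab ba.
have lc1 y : a + y *: b = lc a b 1 y by rewrite /lc scale1r.
set s := xi' + rho; set t := rho' + xi; split; last first.
  case=> [->|[->|->]|[g [s1 t1 /eqP gN1 ->]]|[g [/eqP s1 gE /eqP dn0 ->]]] //.
  - by rewrite linear0l.
  - have d : 1 + g != 0 by rewrite addrC addr_eq0.
    rewrite lc1 lcZ mE; congr lc.
      by rewrite -[xi'](addrK rho) -/s s1; field.
    by rewrite -[rho'](addrK xi) -/t t1; field.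
  rewrite lc1 lcZ mE.
  have gE' : g * (s - 1) = t - 1 by rewrite gE divfK // subr_eq0.
  (* Eliminating [rho'] and [xi'] builds the relation between [g], [s] and [t] into the goal,
     leaving rational identities. *)
  have tE : rho' = 1 + g * (s - 1) - xi by rewrite gE' /t; ring.
  have xE : xi' = s - rho by rewrite /s; ring.
  by rewrite xE tE; congr lc; field.
have [x [y ->]] := lc_surj ab_basis u; rewrite mE.
case/(lc_inj ab_basis)=> ex ey.
have [x0 | xn0] := eqVneq x 0.
  have: y * (y - 1) = 0 by rewrite mulrBr mulr1 -{3}ey x0; ring.
  move/eqP; rewrite mulf_eq0 subr_eq0 x0 => /orP[]/eqP->.
    by rewrite -lc00; constructor 1.
  by constructor 2; right; rewrite -lc01.
have [y0 | yn0] := eqVneq y 0.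
  have: x * (x - 1) = 0 by rewrite mulrBr mulr1 -{3}ex y0; ring.
  move/eqP; rewrite mulf_eq0 subr_eq0 (negPf xn0) y0 => /eqP->.
  by constructor 2; left; rewrite -lc10.
have xs : x + y * s = 1.
  by apply: (mulfI xn0); rewrite mulr1 -[RHS]ex /s; ring.
have yt : y + x * t = 1.
  by apply: (mulfI yn0); rewrite mulr1 -[RHS]ey /t; ring.
pose g := y / x.
have d : 1 + g * s = x^-1.
  by rewrite -[RHS]mul1r -[X in X / x]xs /g; field.
have dn0 : 1 + g * s != 0 by rewrite d invr_neq0.
have uE : lc a b x y = (1 + g * s)^-1 *: (a + g *: b).
  by rewrite lc1 lcZ d invrK mulr1 /g mulrC divfK.
have gE : g * (s - 1) = t - 1.
  apply: (mulIf xn0).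
  have -> : g * (s - 1) * x = y * s - y by rewrite /g; field.
  have ys : y * s = 1 - x by rewrite -xs; ring.
  have xt : x * t = 1 - y by rewrite -yt; ring.
  by rewrite ys mulrBl [t * x]mulrC xt; ring.
have [s1 | s_neq1] := eqVneq s 1.
  constructor 3; exists g; rewrite s1 mulr1 in dn0 uE.
  split=> //; first by apply/eqP; rewrite -subr_eq0 -gE s1 subrr mulr0.
  by move=> gN1; rewrite gN1 subrr eqxx in dn0.
constructor 4; exists g; split=> //; try exact/eqP.
by rewrite -gE mulfK // subr_eq0.
Qed.

(** * Isomorphisms onto the model algebras *)

(** The functions [p] and [q] read off coordinates along [a'] and [b'], which gives the inverse map
    explicitly; equal structure constants make the map multiplicative. Serves both the product of
    two copies of [F] and the table algebras. *)
Lemma alg_isom_coordinates (F : fieldType) (A B : vectType F)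
    (m : {bilinear A -> A -> A}) (mB : B -> B -> B) (a b : A) (a' b' : B)
    (p q : B -> F) (rho xi rho' xi' : F) :
  basis_of {:A} [:: a; b] -> m a a = a -> m b b = b ->
  m a b = lc a b rho xi -> m b a = lc a b xi' rho' ->
  (forall u, u = lc a' b' (p u) (q u)) ->
  (forall x y, p (lc a' b' x y) = x /\ q (lc a' b' x y) = y) ->
  (forall x y z t, mB (lc a' b' x y) (lc a' b' z t) =
    lc a' b' (x * z + x * t * rho + y * z * xi')
             (y * t + x * t * xi + y * z * rho')) ->
  exists2 f : {linear A -> B}, alg_isom m mB f & f a = a' /\ f b = b'.
Proof.
move=> ab_basis aa bb ab ba surj pq mBE.
have [f /(_ (basis_free ab_basis) erefl)[fa fb]] :=
  linear_of_free [:: a; b] [:: a'; b'].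
have fE x y : f (lc a b x y) = lc a' b' x y.
  by rewrite /lc linearD !linearZ /= fa fb.
exists f => //; split.
  exists (fun u => lc a b (p u) (q u)) => u; last by rewrite fE -surj.
  by have [x [y ->]] := lc_surj ab_basis u; rewrite fE; have [-> ->] := pq x y.
move=> u v; have [x [y ->]] := lc_surj ab_basis u.
have [z [t ->]] := lc_surj ab_basis v.
by rewrite (mul_lc aa bb ab ba) !fE mBE.
Qed.

(** Common source of the isomorphisms with [UE_mul] and the two band algebras, which differ only in
    the off-diagonal entries of the table. *)
Lemma isom_on_table_mul (F : fieldType) (A : vectType F)
    (m : {bilinear A -> A -> A}) (a b : A) (rho xi rho' xi' : F)
    (c : 'I_2 -> 'I_2 -> {ffun 'I_2 -> F^o}) :
  basis_of {:A} [:: a; b] -> m a a = a -> m b b = b ->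
  m a b = lc a b rho xi -> m b a = lc a b xi' rho' ->
  (forall i, c i i = basis_elt F i) ->
  c 0 1 = lc (basis_elt F 0) (basis_elt F 1) rho xi ->
  c 1 0 = lc (basis_elt F 0) (basis_elt F 1) xi' rho' ->
  isom_on m (tnth [tuple a; b]) (table_mul c).
Proof.
move=> ab_basis aa bb ab ba cii c01 c10.
have coord (x y : F) : forall i,
    lc (basis_elt F (0 : 'I_2)) (basis_elt F 1) x y i = if i == 0 then x else y.
  move=> i; rewrite !ffunE; case: i => [[|[|i]] //= ltn] /=;
  by rewrite /GRing.scale /= ?mulr0 ?mulr1 ?addr0 ?add0r.
have [||| f f_isom [fa fb]] := @alg_isom_coordinates _ _ _ m (table_mul c) a b
  (basis_elt F 0) (basis_elt F 1) (fun u => u 0) (fun u => u 1)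
  _ _ _ _ ab_basis aa bb ab ba.
- move=> u; apply/ffunP=> i; rewrite coord.
  by case: i => [[|[|i]] //= ltn] /=; congr (u _); apply: val_inj.
- by move=> x y; rewrite !coord.
- by apply: mul_lc; rewrite /= table_mulE // cii.
by exists f => // i; case: i => [[|[|i]] //= ltn].
Qed.

(** * The commutative and noncommutative cases *)

Theorem theorem2p4 (F : fieldType) (A : vectType F)
    (m : {bilinear A -> A -> A}) (a b : A)
    (char_neq2 : 2%N \notin [pchar F])
    (dimA : \dim {:A} = 2%N)
    (genA : forall x : A, in_gen m [:: a; b] x)
    (axis_a : axis m a) (axis_b : axis m b)
    (nontrivial_a : nontrivial m a) (nontrivial_b : nontrivial m b) :
  [/\ basis_of {:A} [:: a; b],
      weakly_primitive m a,
      weakly_primitive m b &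
  forall rho xi rho' xi' : F,
    m a b = rho *: a + xi *: b ->
    m b a = xi' *: a + rho' *: b ->
  [/\ forall p, eigenvalue2 m a p <-> p = (1, 1) \/ p = (xi, rho'),
      forall p, eigenvalue2 m b p <-> p = (1, 1) \/ p = (xi', rho),
      forall x : A, idempotent_elt m x <->
        [\/ x = 0,
            x = a \/ x = b,
            exists gamma : F,
              [/\ xi' + rho = 1, rho' + xi = 1, gamma <> -1
                & x = (1 + gamma)^-1 *: (a + gamma *: b)]
          | exists gamma : F,
              [/\ xi' + rho <> 1,
                  gamma = (rho' + xi - 1) / (xi' + rho - 1),
                  1 + gamma * (xi' + rho) <> 0
                & x = (1 + gamma * (xi' + rho))^-1 *: (a + gamma *: b)]]
    & [/\ forall x y, m x y = m y x,
          xi' = rho /\ rho' = xi,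
          (forall p, eigenvalue2 m a p <-> p = (1, 1) \/ p = (xi, xi)) /\
          (forall p, eigenvalue2 m b p <-> p = (1, 1) \/ p = (rho, rho)),
          fusion_rules m a /\ fusion_rules m b <->
            xi = rho /\ [\/ rho = 0, rho = 2^-1 | rho = -1]
        & xi = 0 -> rho = 0 ->
            [/\ m a b = 0, m b a = 0 &
                exists f : {linear A -> (F^o * F^o)%type},
                  alg_isom m (fun u v : (F^o * F^o)%type => u * v) f]]
      \/
      [/\ ~ (forall x y, m x y = m y x),
          xi + rho = 1, xi' + rho' = 1,
          ~ (rho = 2^-1 /\ rho' = 2^-1)
        & (xi, rho') <> (1, 1) -> (xi', rho) <> (1, 1) ->
          (fusion_rules m a <-> xi = xi') /\
          (xi = xi' ->
            [/\ rho = rho' /\ (rho <> 2^-1 /\ rho' <> 2^-1),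
                fusion_rules m b,
                UE_params xi rho /\
                  isom_on m (tnth [tuple a; b]) (UE_mul 'I_2 xi rho),
                (xi, rho) = (1, 0) ->
                  isom_on m (tnth [tuple a; b])
                    (semigroup_alg_mul F (@right_zero_band 'I_2))
              & (xi, rho) = (0, 1) ->
                  isom_on m (tnth [tuple a; b])
                    (semigroup_alg_mul F (@left_zero_band 'I_2))])]]].
Proof.
have aa : m a a = a by case: axis_a.
have bb : m b b = b by case: axis_b.
have two_neq0 : (2 : F) != 0 by move: char_neq2; rewrite inE /=.
have ab_basis : basis_of {:A} [:: a; b].
  by apply: (in_gen_basis2 dimA genA) => //; apply/eqP; case: nontrivial_a.
have axisP rho xi rho' xi' (ab : m a b = lc a b rho xi)
    (ba : m b a = lc a b xi' rho') :=
  two_generated_axis ab_basis aa bb ab ba axis_a nontrivial_a.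
(* Exchanging [a] and [b] exchanges [rho] with [rho'] and [xi] with [xi']. *)
have axisP' rho xi rho' xi' (ab : m a b = lc a b rho xi)
    (ba : m b a = lc a b xi' rho') :=
  two_generated_axis (basis2C ab_basis) bb aa
    (etrans ba (lcC a b _ _)) (etrans ab (lcC a b _ _)) axis_b nontrivial_b.
have [r [x ab]] := lc_surj ab_basis (m a b).
have [x' [r' ba]] := lc_surj ab_basis (m b a).
split=> //; [by case: (axisP _ _ _ _ ab ba) => ? []
            |by case: (axisP' _ _ _ _ ab ba) => ? [] |].
move=> rho xi rho' xi' {r x x' r'}{}ab {}ba.
have [c [[rhoE xi'E] neq1 _ eig_a fus_a]] := axisP _ _ _ _ ab ba.
have [d [[rho'E xiE] neq1' _ eig_b fus_b]] := axisP' _ _ _ _ ab ba.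
split=> //; first exact: idempotent_lc.
have mC : rho' = xi -> xi' = rho -> forall u v, m u v = m v u.
  move=> rx xr u v; have [x [y ->]] := lc_surj ab_basis u.
  have [z [t ->]] := lc_surj ab_basis v.
  by rewrite !(mul_lc aa bb ab ba) rx xr; congr lc; ring.
have [rx | rho'_neq_xi] := eqVneq rho' xi.
  left; have xr : xi' = rho by rewrite rhoE xi'E rx.
  move: fus_a fus_b eig_a eig_b; rewrite rx xr => fus_a fus_b eig_a eig_b.
  have xi_neq1 : xi != 1 by apply/eqP=> xi1; apply: neq1; rewrite rx xi1.
  have rho_neq1 : rho != 1 by apply/eqP=> rho1; apply: neq1'; rewrite xr rho1.
  (* Multiplying [1 + 2 c xi] by the nonzero [xi - 1] eliminates [c], because [c (xi - 1) = rho]. *)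
  have fus_aE : fusion_rules m a <-> xi = 0 \/ xi - 1 + 2 * rho * xi = 0.
    have E : xi - 1 + 2 * rho * xi = (xi - 1) * (1 + c * (xi + xi)).
      by rewrite rhoE; ring.
    rewrite fus_a E; split=> [[[->] | ->] | [-> | /eqP]];
      rewrite ?mulr0; try tauto.
    by rewrite mulf_eq0 subr_eq0 (negPf xi_neq1) => /eqP; right.
  have fus_bE : fusion_rules m b <-> rho = 0 \/ rho - 1 + 2 * rho * xi = 0.
    have E : rho - 1 + 2 * rho * xi = (rho - 1) * (1 + d * (rho + rho)).
      by rewrite xiE; ring.
    rewrite fus_b E; split=> [[[->] | ->] | [-> | /eqP]];
      rewrite ?mulr0; try tauto.
    by rewrite mulf_eq0 subr_eq0 (negPf rho_neq1) => /eqP; right.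
  split=> //; first exact: mC.
    rewrite fus_aE fus_bE; split.
      (* The mixed alternatives force [rho = 1] or [xi = 1], both excluded. If both polynomials
         vanish, their difference gives [xi = rho], and what remains factors as
         [(2 rho - 1) (rho + 1) = 0]. *)
      case=> [[xi0 | Exi] [rho0 | Erho]].
      - by rewrite xi0 rho0; split; [|constructor 1].
      - case/eqP: rho_neq1; apply/eqP; rewrite -subr_eq0 -Erho xi0.
        by apply/eqP; ring.
      - case/eqP: xi_neq1; apply/eqP; rewrite -subr_eq0 -Exi rho0.
        by apply/eqP; ring.
      have xi_rho : xi = rho.
        apply/eqP; rewrite -subr_eq0; apply/eqP.
        have -> : xi - rho =
          xi - 1 + 2 * rho * xi - (rho - 1 + 2 * rho * xi) by ring.
        by rewrite Exi Erho subrr.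
      split=> //; have: (2 * rho - 1) * (rho + 1) = 0.
        by rewrite -[RHS]Erho xi_rho; ring.
      move/eqP; rewrite mulf_eq0 subr_eq0 addr_eq0 => /orP[/eqP rho2|/eqP->].
        by constructor 2; apply: (mulfI two_neq0); rewrite rho2 mulfV.
      by constructor 3.
    case=> -> [] rhoV; first by split; left.
      by rewrite rhoV; split; right; field.
    by rewrite rhoV; split; right; ring.
  move=> xi0 rho0; move: ab ba; rewrite xr rx xi0 rho0 !scale0r addr0.
  move=> ab0 ba0; split=> //.
  have pairE (x y : F) : lc ((1, 0) : F^o * F^o) (0, 1) x y = (x, y).
    transitivity (x * 1 + y * 0, x * 0 + y * 1); first by [].
    by rewrite !mulr1 !mulr0 addr0 add0r.
  have [||||| f f_isom _] := @alg_isom_coordinates _ _ (F^o * F^o)%type m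
    (fun u v => u * v) a b (1, 0) (0, 1) fst snd 0 0 0 0 ab_basis aa bb.
  - by rewrite -lc00.
  - by rewrite -lc00.
  - by case=> x y; rewrite pairE.
  - by move=> x y; rewrite pairE.
  - by move=> x y z t; rewrite !pairE; congr (_, _) => /=; ring.
  by exists f.
right.
(* Subtracting the equations in [c], and those in [d], gives [rho' - xi = d (xi' - rho) = c d (rho'
   - xi)]. *)
have cd1 : c * d = 1.
  have n0 : rho' - xi != 0 by rewrite subr_eq0.
  have rx : rho - xi' = c * (xi - rho') by rewrite rhoE xi'E; ring.
  have xr : rho' - xi = d * (xi' - rho) by rewrite rho'E xiE; ring.
  apply: (mulIf n0); rewrite mul1r [RHS]xr.
  have -> : xi' - rho = c * (rho' - xi) by rewrite -opprB rx; ring.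
  by ring.
(* Multiplying [xi = d (rho - 1)] by [c] gives [c xi = rho - 1], while [rhoE] reads
   [c = c xi - rho]. *)
have cN1 : c = -1.
  have cxi : c * xi = rho - 1 by rewrite {1}xiE mulrA cd1 mul1r.
  have cE : c = c * xi - rho by rewrite [in RHS]rhoE; ring.
  by rewrite cE cxi; ring.
have dN1 : d = -1 by apply: oppr_inj; rewrite opprK -cd1 cN1; ring.
have xi_rho : xi + rho = 1 by rewrite rhoE cN1; ring.
have xi'_rho' : xi' + rho' = 1 by rewrite xi'E cN1; ring.
have half : 1 - 2^-1 = 2^-1 :> F by field.
split=> //.
- move=> comm; have := comm a b; rewrite ab ba.
  by case/(lc_inj ab_basis)=> _ /esym/eqP; rewrite (negPf rho'_neq_xi).
- case=> rho2 rho'2; case/eqP: rho'_neq_xi.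
  by rewrite -[xi](addrK rho) xi_rho rho2 rho'2 half.
move=> _ _.
(* With [c = -1] the second alternative is [xi + rho' = 1], that is, [xi = xi']; the first would
   make the second eigenvalue [(xi', rho)] of [b] equal to [(1, 1)]. *)
have sum_a : fusion_rules m a <-> xi = xi'.
  rewrite fus_a cN1; split=> [[[xi0 rho'0] | /eqP] | xi_eq].
  - case: neq1'; rewrite -[xi'](addrK rho') xi'_rho' rho'0 subr0.
    by rewrite -[rho](addKr xi) xi_rho xi0 oppr0 add0r.
  - rewrite mulN1r subr_eq0 => /eqP xr'; apply: (addIr rho').
    by rewrite xi'_rho' -xr'.
  by right; rewrite xi_eq xi'_rho'; ring.
split=> // xi_eq.
have rho_eq : rho = rho' by apply: (addrI xi); rewrite xi_rho xi_eq xi'_rho'.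
(* Otherwise [rho' = rho = 1/2 = xi], which is the commutative case. *)
have rho_half : rho <> 2^-1.
  move=> rho2; case/eqP: rho'_neq_xi; rewrite -rho_eq -[xi](addrK rho) xi_rho.
  by rewrite rho2 half.
have ba' : m b a = lc a b xi rho by rewrite ba xi_eq rho_eq.
split=> //.
- by rewrite -rho_eq.
- by apply/fus_b; right; rewrite dN1 -xi_eq xi_rho; ring.
- split; first by left=> xr; apply: rho_half; apply: (mulfI two_neq0);
    rewrite mulfV // mulr_natl mulr2n -{1}xr xi_rho.
  apply: (isom_on_table_mul ab_basis aa bb ab ba') => //= [i|].
    by rewrite eqxx.
  exact: addrC.
(* Here [ab = b] and [ba = a], the right-zero product; the remaining case is the left-zero one. *)
- case=> xi1 rho0.
  apply: (isom_on_table_mul ab_basis aa bb ab ba') => //=.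
    by rewrite xi1 rho0 -lc01.
  by rewrite xi1 rho0 -lc10.
case=> xi0 rho1.
apply: (isom_on_table_mul ab_basis aa bb ab ba') => //=.
  by rewrite xi0 rho1 -lc10.
by rewrite xi0 rho1 -lc01.
Qed.
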